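(* For a word $\sigma=\sigma_1\cdots\sigma_n$ over $\{1,\dots,k\}$, say $\sigma$ avoids $21\text{-}1$ if there are no indices $i,j$ with $j>i+1$ and $\sigma_i>\sigma_{i+1}=\sigma_j$, and $\sigma$ avoids $21\text{-}2$ if there are no indices $i,j$ with $j>i+1$ and $\sigma_{i+1}<\sigma_i=\sigma_j$. Let $[k]^n(\tau)$ be the set of words of length $n$ over $\{1,\dots,k\}$ avoiding $\tau$, and $F_\tau(x;k)=\sum_{n\ge0}|[k]^n(\tau)|x^n$. Then the patterns $21\text{-}1$ and $21\text{-}2$ are Wilf-equivalent, i.e. $|[k]^n(21\text{-}1)|=|[k]^n(21\text{-}2)|$ for all $k,n\ge0$, and for all $k\ge0$, \[ F_{21\text{-}2}(x;k)=F_{21\text{-}1}(x;k)=1+\sum_{d=0}^{k-1}\left(x^{d+1}F_{21\text{-}1}(x;k-d)\sum_{i=d}^{k-1}(1-x)^{i-d}\binom{i}{d}\right). \]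
   Context: The empty word (length $0$) is counted once; $[0]^n$ is empty for $n\ge1$. *)

(* Defs.v *)
From HB Require Import structures.
From mathcomp Require Import all_boot all_order all_algebra.
From mathcomp Require Import boolp.

Set Implicit Arguments.
Unset Strict Implicit.
Unset Printing Implicit Defensive.

Import GRing.Theory.
Local Open Scope ring_scope.

(* [fps R] is the ring R[[x]] of formal power series: addition is
   coefficientwise and multiplication is the Cauchy product. *)
Record fps (R : Type) := Fps { fcoef : nat -> R }.

Lemma fpsP (R : Type) (f g : fps R) : fcoef f =1 fcoef g -> f = g.
Proof. by case: f g => [f] [g] /= /funext ->. Qed.

HB.instance Definition _ (R : Type) := gen_eqMixin (fps R).
HB.instance Definition _ (R : Type) := gen_choiceMixin (fps R).

Section FpsRing.
Variable R : comNzRingType.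
Implicit Types f g h : fps R.

Definition fps0 : fps R := Fps (fun=> 0).
Definition fps_opp f : fps R := Fps (fun n => - fcoef f n).
Definition fps_add f g : fps R := Fps (fun n => fcoef f n + fcoef g n).
Definition fps1 : fps R := Fps (fun n => (n == 0%N)%:R).
Definition fps_mul f g : fps R :=
  Fps (fun n => \sum_(i < n.+1) fcoef f i * fcoef g (n - i)%N).

Fact fps_addA : associative fps_add.
Proof. by move=> f g h; apply: fpsP => n /=; rewrite addrA. Qed.
Fact fps_addC : commutative fps_add.
Proof. by move=> f g; apply: fpsP => n /=; rewrite addrC. Qed.
Fact fps_add0 : left_id fps0 fps_add.
Proof. by move=> f; apply: fpsP => n /=; rewrite add0r. Qed.
Fact fps_addN : left_inverse fps0 fps_opp fps_add.
Proof. by move=> f; apply: fpsP => n /=; rewrite addNr. Qed.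

HB.instance Definition _ :=
  GRing.isZmodule.Build (fps R) fps_addA fps_addC fps_add0 fps_addN.

Let tr n f : {poly R} := \poly_(i < n.+1) fcoef f i.

Let coef_tr n f i : (i <= n)%N -> (tr n f)`_i = fcoef f i.
Proof. by move=> le_in; rewrite coef_poly ltnS le_in. Qed.

Let coef_fps_mul n f g i : (i <= n)%N ->
  fcoef (fps_mul f g) i = (tr n f * tr n g)`_i.
Proof.
move=> le_in; rewrite coefM; apply: eq_bigr => j _.
have le_ji : (j <= i)%N by rewrite -ltnS.
rewrite !coef_tr //; first exact: leq_trans (leq_subr _ _) le_in.
exact: leq_trans le_ji le_in.
Qed.

Fact fps_mulC : commutative fps_mul.
Proof.
by move=> f g; apply: fpsP => n; rewrite !(@coef_fps_mul n) // mulrC.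
Qed.

Fact fps_mulA : associative fps_mul.
Proof.
move=> f g h; apply: fpsP => n.
transitivity ((tr n f * (tr n g * tr n h))`_n).
  rewrite coefM; apply: eq_bigr => i _; congr (_ * _).
    by rewrite coef_tr // -ltnS.
  by rewrite (@coef_fps_mul n) // leq_subr.
rewrite mulrA coefM; apply: eq_bigr => i _; congr (_ * _).
  by rewrite (@coef_fps_mul n) // -ltnS.
by rewrite coef_tr // leq_subr.
Qed.

Fact fps_mul1 : left_id fps1 fps_mul.
Proof.
move=> f; apply: fpsP => n /=.
rewrite big_ord_recl mul1r subn0 big1 ?addr0 // => i _.
by rewrite mul0r.
Qed.

Fact fps_mulDl : left_distributive fps_mul fps_add.
Proof.
move=> f g h; apply: fpsP => n /=.
by rewrite -big_split; apply: eq_bigr => i _; rewrite mulrDl.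
Qed.

Fact fps1_neq0 : fps1 != 0.
Proof.
apply/eqP => /(congr1 (fun f => fcoef f 0)) /= /eqP.
by rewrite oner_eq0.
Qed.

HB.instance Definition _ := GRing.Zmodule_isComNzRing.Build (fps R)
  fps_mulA fps_mulC fps_mul1 fps_mulDl fps1_neq0.

Definition fpsX : fps R := Fps (fun n => (n == 1%N)%:R).

End FpsRing.

Arguments fpsX {R}.

Local Open Scope nat_scope.

(* The letters 1 < ... < k are encoded by 'I_k, and positions are numbered
   from 0; below, [i'] is the position that follows [i]. *)
Definition avoids_21_1 (k n : nat) (w : n.-tuple 'I_k) : bool :=
  ~~ [exists i : 'I_n, exists i' : 'I_n, exists j : 'I_n,
        [&& i' == i.+1 :> nat, i.+1 < j,
            tnth w i' < tnth w i & tnth w i' == tnth w j]].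

Definition avoids_21_2 (k n : nat) (w : n.-tuple 'I_k) : bool :=
  ~~ [exists i : 'I_n, exists i' : 'I_n, exists j : 'I_n,
        [&& i' == i.+1 :> nat, i.+1 < j,
            tnth w i' < tnth w i & tnth w i == tnth w j]].

Definition words_21_1 (k n : nat) : {set n.-tuple 'I_k} :=
  [set w | avoids_21_1 w].

Definition words_21_2 (k n : nat) : {set n.-tuple 'I_k} :=
  [set w | avoids_21_2 w].

Definition F_21_1 (k : nat) : fps int := Fps (fun n => #|words_21_1 k n|%:Z).

Definition F_21_2 (k : nat) : fps int := Fps (fun n => #|words_21_2 k n|%:Z).

(* Main.v *)
(** Reading a word from left to right, a descent [a > b] forbids one letter in
    the rest of the word: [b] for 21-1, [a] for 21-2. The number of ways to
    continue after a letter therefore only depends on the number [k] of letters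
    still allowed and on the number [t] of those that are below the last
    letter. Both patterns give the same recurrence on the length [n],
      [d (n+1) k t = \sum_(t <= s < k) d n k s + \sum_(s < t) d n (k-1) s],
    since the [s] of the second sum are the ranks of the letters making a
    descent. For the generating functions [D k t] of [d], subtracting the
    recurrences at [t] and [t+1] gives
      [D k (t+1) = (1 - x) D k t + x D (k-1) t],
    a Pascal-type rule, whence [D k t] is a binomial sum of the
    [D (k-d) 0 = F (k-d)]; then [F k = 1 + x \sum_(s < k) D k s]. *)
Require Import Defs.
From mathcomp Require Import all_boot all_order all_algebra ring.

Set Implicit Arguments.
Unset Strict Implicit.
Unset Printing Implicit Defensive.

Import GRing.Theory.

(** This is [d n k t] of the recurrence. The value [t = 0] also covers a word not yet begun, as no
    descent can come next. *)
Fixpoint continuations (n k t : nat) : nat :=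
  if n is m.+1 then
    \sum_(t <= s < k) continuations m k s + \sum_(s < t) continuations m k.-1 s
  else 1.

Section Words.

Variable k : nat.
Implicit Types (S : {set 'I_k}) (a b : 'I_k) (w : seq 'I_k).

(** * Ranks of letters in a set of allowed letters *)

Definition rank S a := #|[set b in S | b < a]|.

Lemma rank_le S a b : a <= b -> rank S a <= rank S b.
Proof.
move=> le_ab; apply/subset_leq_card/subsetP => c; rewrite !inE => /andP[-> lt_ca].
exact: leq_trans le_ab.
Qed.

Lemma ltn_rank S a b : a \in S -> (rank S a < rank S b) = (a < b).
Proof.
move=> aS; case: (ltnP a b) => [lt_ab | le_ba]; last first.
  by apply/negbTE; rewrite -leqNgt rank_le.
apply/proper_card/properP; split.
  by apply/subsetP => c; rewrite !inE => /andP[-> /ltn_trans]; apply.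
by exists a; rewrite !inE aS // ltnn.
Qed.

Lemma rank_lt_card S a : a \in S -> rank S a < #|S|.
Proof.
move=> aS; apply/proper_card/properP; split.
  by apply/subsetP => c; rewrite !inE => /andP[].
by exists a; rewrite ?inE ?ltnn ?andbF.
Qed.

Lemma rankD1 S a b : b <= a -> rank (S :\ a) b = rank S b.
Proof.
move=> le_ba; apply: eq_card => c; rewrite !inE.
by case: eqP => [->|_] //=; rewrite ltnNge le_ba andbF.
Qed.

(** [rank S] is injective on [S] with values below [#|S|], hence a bijection from [S] onto
    [0, ..., #|S| - 1]. *)
Lemma sum_rank S (G : nat -> nat) :
  \sum_(b in S) G (rank S b) = \sum_(0 <= s < #|S|) G s.
Proof.
rewrite -big_enum -(big_map (rank S) xpredT G) /index_iota subn0.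
apply: perm_big.
have uniq_rank : uniq [seq rank S b | b <- enum S].
  rewrite map_inj_in_uniq ?enum_uniq // => a b.
  rewrite !mem_enum => aS bS eq_ab; apply: val_inj.
  by case: (ltngtP a b) => //; rewrite -(@ltn_rank S) // eq_ab ltnn.
apply: uniq_perm => //; first exact: iota_uniq.
suff sub_rank : {subset [seq rank S b | b <- enum S] <= iota 0 #|S|}.
  by apply: (uniq_min_size uniq_rank sub_rank _).2; rewrite size_map size_iota -cardE.
move=> _ /mapP[b bS ->]; rewrite mem_enum in bS.
by rewrite mem_iota /= rank_lt_card.
Qed.

(** * Counting words by their first letter *)

Definition count_words n (P : pred (seq 'I_k)) :=
  \sum_(w : n.-tuple 'I_k) (P w : nat).

Lemma count_words0 P : count_words 0 P = P [::].
Proof.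
rewrite /count_words (big_pred1 [tuple]) // => w.
by apply/esym/eqP; apply: tuple0.
Qed.

Lemma count_wordsS n P :
  count_words n.+1 P = \sum_b count_words n (fun w => P (b :: w)).
Proof.
rewrite /count_words pair_big /=.
rewrite (reindex (fun p : 'I_k * n.-tuple 'I_k => cons_tuple p.1 p.2)) //=.
exists (fun u => (thead u, behead_tuple u)) => [[b u] _ | u _] /=.
  by rewrite theadE; congr pair; apply: val_inj.
by rewrite [RHS]tuple_eta; apply: val_inj.
Qed.

Lemma count_words_false n : count_words n pred0 = 0.
Proof. by rewrite /count_words big1. Qed.

Lemma eq_count_words n P Q : P =1 Q -> count_words n P = count_words n Q.
Proof. by move=> eqPQ; apply: eq_bigr => w _; rewrite eqPQ. Qed.

Lemma count_wordsE n (P : pred (n.-tuple 'I_k)) (Q : pred (seq 'I_k)) :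
  (forall u, P u = Q u) -> #|[set w | P w]| = count_words n Q.
Proof.
move=> eqPQ; rewrite -sum1_card /count_words big_mkcond.
by apply: eq_bigr => u _; rewrite inE eqPQ; case: (Q u).
Qed.

(** * Pattern avoidance and the common recurrence *)

(* [sel a b] is the letter forbidden after a descent [a > b]. *)
Fixpoint avoids (sel : 'I_k -> 'I_k -> 'I_k) (w : seq 'I_k) : bool :=
  if w is a :: w' then
    (if w' is b :: u then (b < a) ==> (sel a b \notin u) else true)
    && avoids sel w'
  else true.

Lemma avoidsP sel x0 w :
  reflect (forall i j, i.+1 < j < size w -> nth x0 w i.+1 < nth x0 w i ->
             sel (nth x0 w i) (nth x0 w i.+1) != nth x0 w j)
          (avoids sel w).
Proof.
elim: w => [|a [|b u] IHw]; first by left=> i j; rewrite andbF.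
  by left=> i [|j] //=; rewrite ?ltnS ?ltn0 andbF.
rewrite [avoids _ _]/=; apply: (iffP andP) => [[ab_ok /IHw w_ok] | w_ok].
  case=> [|i] [|j] //=; last exact: (w_ok i j).
  case: j => // j /=; rewrite !ltnS => lt_ju lt_ba.
  move: ab_ok; rewrite lt_ba; apply: contraNneq => ->.
  exact: mem_nth.
split; last by apply/IHw => i j; apply: (w_ok i.+1 j.+1).
apply/implyP => lt_ba; apply/negP => /(nthP x0)[j lt_ju def_j].
by have := w_ok 0 j.+2 lt_ju lt_ba; rewrite /= def_j eqxx.
Qed.

(** The two projections [sel] turn the left side into [avoids_21_1] and [avoids_21_2]. *)
Lemma avoids_tuple sel n (w : n.-tuple 'I_k) :
  ~~ [exists i : 'I_n, exists i' : 'I_n, exists j : 'I_n,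
        [&& i' == i.+1 :> nat, i.+1 < j,
            tnth w i' < tnth w i & sel (tnth w i) (tnth w i') == tnth w j]]
  = avoids sel w.
Proof.
case: n w => [|n] w.
  by rewrite [w]tuple0; apply/existsP => -[[]].
have x0 := tnth w ord0; apply/idP/(avoidsP sel x0).
  move=> no_occ i j; rewrite size_tuple => /andP[lt_ij lt_jn] desc.
  apply: contra no_occ => occ.
  have lt_i'n := ltn_trans lt_ij lt_jn.
  apply/existsP; exists (Ordinal (ltnW lt_i'n)).
  apply/existsP; exists (Ordinal lt_i'n); apply/existsP; exists (Ordinal lt_jn).
  by rewrite !(tnth_nth x0) /= eqxx lt_ij desc.
move=> w_ok; apply/existsP => -[i /existsP[i' /existsP[j]]].
case/and4P=> /eqP def_i' lt_ij; rewrite !(tnth_nth x0) def_i' => desc.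
by apply/negP/w_ok; rewrite // size_tuple lt_ij ltn_ord.
Qed.

(* [S' b] is the alphabet left after the descent [a > b]: it will be [S :\ b]
   for 21-1 and [S :\ a] for 21-2. *)
Lemma sum_continuations n S a (S' : 'I_k -> {set 'I_k}) :
    (forall b, b \in S -> b < a -> #|S' b| = #|S|.-1) ->
    (forall b, b \in S -> b < a -> rank (S' b) b = rank S b) ->
  \sum_(b in S) (if b < a then continuations n #|S' b| (rank (S' b) b)
                 else continuations n #|S| (rank S b))
  = continuations n.+1 #|S| (rank S a).
Proof.
move=> card_S' rank_S'.
pose G s := if s < rank S a then continuations n #|S|.-1 s
            else continuations n #|S| s.
rewrite (eq_bigr (fun b => G (rank S b))) => [|b bS]; last first.
  by rewrite /G ltn_rank //; case: ifP => // lt_ba; rewrite card_S' ?rank_S'.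
have le_aS : rank S a <= #|S|.
  by apply/subset_leq_card/subsetP => c; rewrite !inE => /andP[].
rewrite sum_rank (big_cat_nat (leq0n _) le_aS) //= addnC; congr (_ + _).
  by apply: eq_big_nat => s /andP[le_as _]; rewrite /G ltnNge le_as.
by rewrite big_mkord; apply: eq_bigr => s _; rewrite /G ltn_ord.
Qed.

(** Here [a] may lie outside [S]: after a descent onto [a], this letter is itself forbidden. *)
Lemma count_after_21_1 n S a :
  count_words n (fun w => all (mem S) w && avoids (fun _ b => b) (a :: w))
  = continuations n #|S| (rank S a).
Proof.
elim: n S a => [|n IHn] S a; first by rewrite count_words0.
have cD1 b : b \in S -> #|S :\ b| = #|S|.-1 by move=> bS; rewrite (cardsD1 b S) bS.
rewrite -(@sum_continuations n S a (fun b => S :\ b)); first last.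
- by move=> b _ _; rewrite rankD1.
- by move=> b /cD1.
rewrite count_wordsS [RHS]big_mkcond; apply: eq_bigr => b _ /=.
case: (b \in S) => /=; last exact: count_words_false.
case: ltnP => [lt_ba | le_ab]; rewrite -IHn; apply: eq_count_words => w //=.
rewrite andbA; congr (_ && _).
(* Words over [S] that miss [b] are the words over [S :\ b]. *)
elim: w => //= c w IHw; rewrite -IHw !inE negb_or [b == c]eq_sym.
by case: eqP => //=; rewrite ?andbF //= andbA.
Qed.

(** The last letter stays allowed: a descent from [a] to [b] forbids [a], so [b] is in [S :\ a] and
    the induction goes on. *)
Lemma count_after_21_2 n S a : a \in S ->
  count_words n (fun w => all (mem S) w && avoids (fun a _ => a) (a :: w))
  = continuations n #|S| (rank S a).
Proof.
elim: n S a => [|n IHn] S a aS; first by rewrite count_words0.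
have cD1 : #|S :\ a| = #|S|.-1 by rewrite (cardsD1 a S) aS.
rewrite -(@sum_continuations n S a (fun b => S :\ a)) //; last first.
  by move=> b _ lt_ba; rewrite rankD1 // ltnW.
rewrite count_wordsS [RHS]big_mkcond; apply: eq_bigr => b _ /=.
case: ifP => bS /=; last by exact: count_words_false.
case: ltnP => [lt_ba | le_ab]; rewrite -IHn //; last first.
  by rewrite !inE bS -val_eqE /= neq_ltn lt_ba.
apply: eq_count_words => w /=; rewrite andbA; congr (_ && _).
elim: w => //= c w IHw; rewrite -IHw !inE negb_or [a == c]eq_sym.
by case: eqP => //=; rewrite ?andbF //= andbA.
Qed.

Lemma count_avoids sel n :
    (forall m a, count_words m (fun w => avoids sel (a :: w))
                 = continuations m k (rank setT a)) ->
  count_words n (avoids sel) = continuations n k 0.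
Proof.
move=> count_after; case: n => [|n]; first by rewrite count_words0.
rewrite count_wordsS /= big_ord0 addn0.
have := sum_rank setT (continuations n k); rewrite cardsT card_ord => <-.
apply: eq_big => [b | b _]; first by rewrite inE.
exact: count_after.
Qed.

Lemma all_setT w : all (mem [set: 'I_k]) w.
Proof. by apply/allP => b _; apply: in_setT. Qed.

Lemma card_words_21_1 n : #|words_21_1 k n| = continuations n k 0.
Proof.
rewrite (count_wordsE (avoids_tuple (fun _ b => b) (n := n))).
apply: count_avoids => m a.
have := count_after_21_1 m setT a; rewrite cardsT card_ord => <-.
by apply: eq_count_words => w; rewrite all_setT.
Qed.

Lemma card_words_21_2 n : #|words_21_2 k n| = continuations n k 0.
Proof.
rewrite (count_wordsE (avoids_tuple (fun a _ => a) (n := n))).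
apply: count_avoids => m a.
have := count_after_21_2 m (in_setT a); rewrite cardsT card_ord => <-.
by apply: eq_count_words => w; rewrite all_setT.
Qed.

End Words.

Local Open Scope ring_scope.

(** * Generating functions *)

Lemma fcoefD (R : comNzRingType) (f g : fps R) n :
  fcoef (f + g) n = fcoef f n + fcoef g n.
Proof. by []. Qed.

Lemma fcoef_sum (R : comNzRingType) m p (f : nat -> fps R) n :
  fcoef (\sum_(m <= i < p) f i) n = \sum_(m <= i < p) fcoef (f i) n.
Proof. exact: (big_morph (fun g : fps R => fcoef g n)). Qed.

Lemma fcoef_mulX (R : comNzRingType) (f : fps R) n :
  fcoef (fpsX * f) n = if n is m.+1 then fcoef f m else 0.
Proof.
rewrite /GRing.mul /=; case: n => [|n].
  by rewrite big_ord1 mul0r.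
rewrite big_ord_recl mul0r add0r big_ord_recl mul1r subSS subn0.
by rewrite big1 ?addr0 // => i _; rewrite mul0r.
Qed.

Definition continuation_series (k t : nat) : fps int :=
  Fps (fun n => (continuations n k t)%:Z).

Lemma continuation_seriesE k t :
  continuation_series k t =
    1 + fpsX * (\sum_(t <= s < k) continuation_series k s
                + \sum_(0 <= s < t) continuation_series k.-1 s).
Proof.
apply: fpsP => n; rewrite fcoefD fcoef_mulX; case: n => [|n] //.
rewrite fcoefD !fcoef_sum /= add0r PoszD -[\sum_(s < t) _](big_mkord xpredT) /=.
by rewrite !(big_morph Posz PoszD (erefl _)).
Qed.

Lemma continuation_seriesS k t : (t < k)%N ->
  continuation_series k t.+1 =
    (1 - fpsX) * continuation_series k t + fpsX * continuation_series k.-1 t.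
Proof.
(* Only the first copy of [continuation_series k t] is expanded; the other cancels its term
   [s = t]. *)
move=> lt_tk; rewrite mulrBl mul1r [in X in X - _]continuation_seriesE.
rewrite continuation_seriesE big_nat_recr //= (big_ltn lt_tk).
ring.
Qed.

(* Any bound [m > s] gives the same sum, as ['C(s, d) = 0] for [d > s]; leaving
   it free allows a common range for all [s < k]. *)
Definition binomial_series (k s m : nat) : fps int :=
  \sum_(0 <= d < m)
    fpsX ^+ d * continuation_series (k - d) 0 * ((1 - fpsX) ^+ (s - d) * 'C(s, d)%:R).

Lemma continuation_series_binomial k s m : (s < m)%N -> (s <= k)%N ->
  continuation_series k s = binomial_series k s m.
Proof.
elim: s k m => [|s IHs] k [|m] // lt_sm le_sk; rewrite /binomial_series.
  rewrite big_nat_recl //= !expr0 !mul1r subn0 mulr1 big1 ?addr0 // => i _.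
  by rewrite !mulr0.
rewrite continuation_seriesS // (IHs k m.+1 (ltnW lt_sm) (ltnW le_sk)).
(* The factor [fpsX] shifts [d] by one, so this sum takes the bound [m] instead of [m.+1]. *)
rewrite (IHs _ m) //; last by case: k le_sk.
rewrite /binomial_series !big_nat_recl // mulrDr -addrA; congr (_ + _).
  by rewrite !bin0 !subn0 exprS !mulr1 !mul1r mulrCA.
rewrite !mulr_sumr -big_split /=; apply: eq_bigr => d _.
rewrite binS natrD subSS.
have -> : (k.-1 - d = k - d.+1)%N by case: k {le_sk} => [|k] //; rewrite sub0n.
(* The exponent [s - d.+1] is truncated when [s <= d], but then ['C(s, d.+1) = 0]. *)
have [lt_ds | le_sd] := ltnP d s; last first.
  by rewrite bin_small // mulr0 mulr0 !add0r mulr0 add0r exprS !mulrA.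
by rewrite -[(s - d)%N]subSS subSn // !exprS; ring.
Qed.

Theorem theorem3p4 :
  (forall k n : nat, #|words_21_1 k n| = #|words_21_2 k n|) /\
  (forall k : nat,
    F_21_2 k = F_21_1 k /\
    F_21_1 k =
      1 + \sum_(0 <= d < k)
            (fpsX ^+ d.+1 * F_21_1 (k - d)%N *
             \sum_(d <= i < k) (1 - fpsX) ^+ (i - d)%N * 'C(i, d)%:R)).
Proof.
have F_series k : F_21_1 k = continuation_series k 0.
  by apply: fpsP => n /=; rewrite card_words_21_1.
split=> [k n | k]; first by rewrite card_words_21_1 card_words_21_2.
split; first by apply: fpsP => n /=; rewrite card_words_21_1 card_words_21_2.
rewrite F_series continuation_seriesE [\sum_(0 <= s < 0) _]big_geq // addr0; congr (_ + _).
(* The common bound [m = k] makes the double sum rectangular, so that its order can be exchanged. *)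
under eq_big_nat => s /andP[_ lt_sk].
  rewrite (@continuation_series_binomial k s k lt_sk (ltnW lt_sk)); over.
rewrite exchange_big_nat mulr_sumr; apply: eq_big_nat => d /andP[_ lt_dk].
rewrite -mulr_sumr mulrA [in LHS]mulrA -exprS F_series; congr (_ * _).
(* The terms with [s < d] vanish since ['C(s, d) = 0]. *)
rewrite (big_cat_nat (leq0n d) (ltnW lt_dk)) /= big_nat_cond big1 ?add0r // => s.
by case/andP=> /andP[_ lt_sd] _; rewrite bin_small // mulr0.
Qed.
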